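(* Let $\langle L(T,U)\rangle|_S$ denote the statistical arc length of the Riemann $Z(t)$-curve on $[T,T+U]$. Then, for $U=U(T)\in(0,\sqrt{T}]$, $$\langle L(T,U)\rangle|_S\sim \frac{1}{\sqrt{6\pi}}\,U\ln^{3/2}T,\qquad T\to\infty .$$
   Context: Here $\ln^{a}x=(\ln x)^{a}$, and $f\sim g$ as $T\to\infty$ means $f/g\to 1$. For $T>2\pi$ let $P=\sqrt{T/(2\pi)}$ and let $w_\infty(x)=\frac{1}{2}\sqrt{\frac{3}{\pi}}\,\frac{1}{\ln^{3/2}P}\,e^{-\beta x^2}$, $\beta=\frac{3}{4\ln^3P}$, be the centered Gaussian density with variance $\frac23\ln^3P$. Define the asymptotic expectation $$E_\infty\left(\sqrt{1+(\Phi_1)^2}\right)=\int_{-\infty}^{\infty}\sqrt{1+x^2}\,w_\infty(x)\,dx,$$ and $$E_\infty(\Phi_2)=\int_T^{T+U}E_\infty\left(\sqrt{1+(\Phi_1)^2}\right)dt .$$ The statistical arc length of the Riemann $Z(t)$-curve is by definition $\langle L(T,U)\rangle|_S=E_\infty(\Phi_2)$. (Here $\Phi_1$, $\Phi_2$ are names of random processes motivating the definition, with $\Phi_2=\int_T^{T+U}\sqrt{1+\{\Phi_1(t)\}^2}\,dt$; the quantities $E_\infty(\cdot)$ are defined by the formulas above.) *)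

(* Defs.v *)
From HB Require Import structures.
From mathcomp Require Import all_boot all_order all_algebra.
From mathcomp Require Import all_classical all_reals all_analysis.

Set Implicit Arguments.
Unset Strict Implicit.
Unset Printing Implicit Defensive.

Import Order.TTheory GRing.Theory Num.Theory.
Import numFieldNormedType.Exports.

Local Open Scope classical_set_scope.
Local Open Scope ring_scope.

Definition P {R : realType} (T : R) : R := Num.sqrt (T / (2 * pi)).

Definition beta {R : realType} (T : R) : R := 3 / (4 * ln (P T) ^+ 3).

(* Only meaningful for 2 * pi < T, i.e. 0 < ln (P T); otherwise ln and `^ take
   their default values. *)
Definition w_infty {R : realType} (T x : R) : R :=
  1 / 2 * Num.sqrt (3 / pi) * (1 / (ln (P T) `^ (3 / 2))) *
  expR (- beta T * x ^+ 2).

(* Both integrals are real-valued Lebesgue integrals. *)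
Definition E_infty_Phi1 {R : realType} (T : R) : R :=
  (\int[@lebesgue_measure R]_(x in setT) (Num.sqrt (1 + x ^+ 2) * w_infty T x))%R.

(* The density is taken at the left endpoint T and does not vary with the
   integration variable t, so the integrand is constant. *)
Definition E_infty_Phi2 {R : realType} (T U : R) : R :=
  (\int[@lebesgue_measure R]_(t in `[T, (T + U)%R]) E_infty_Phi1 T)%R.

Definition statistical_arc_length {R : realType} (T U : R) : R :=
  E_infty_Phi2 T U.

Definition asymp_equiv {R : realType} (f g : R -> R) : Prop :=
  f T / g T @[T --> +oo] --> (1 : R).

(* Main.v *)
Require Import Defs.
From HB Require Import structures.
From mathcomp Require Import all_boot all_order all_algebra.
From mathcomp Require Import all_classical all_reals all_analysis.
From mathcomp Require Import measurable_realfun normal_distribution ring lra.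

Set Implicit Arguments.
Unset Strict Implicit.
Unset Printing Implicit Defensive.

Import Order.TTheory GRing.Theory Num.Theory.
Import numFieldNormedType.Exports.

Local Open Scope classical_set_scope.
Local Open Scope ring_scope.

(** By Gaussian symmetry [E |Phi_1| = sigma * sqrt (2 / pi)] for the centered
    normal law of variance [sigma^2 = 2/3 ln^3 P]. Since
    [|x| <= sqrt (1 + x^2) <= |x| + 1], the expectation of [sqrt (1 + Phi_1^2)]
    differs from [sqrt (4 / (3 pi) * ln^3 P)] by at most 1. As
    [ln P = (ln T - ln (2 pi)) / 2], dividing by [ln^(3/2) T / sqrt (6 pi)] gives
    [(1 - ln (2 pi) / ln T)^(3/2)] up to an error tending to 0. *)

Lemma cvgr_ln (R : realType) : @ln R T @[T --> +oo] --> +oo.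
Proof.
apply/cvgryPge => A; near=> T.
have AT : expR A <= T by near: T; apply: nbhs_pinfty_ge; exact: num_real.
by rewrite -(expRK A) ler_ln ?posrE ?expR_gt0 ?(lt_le_trans (expR_gt0 A)).
Unshelve. all: by end_near. Qed.

(** The integrand is even, so the integral is twice the one over the half-line, where
    [x * expR (- b * x ^+ 2)] has the elementary primitive [F]; this gives [2 * (2 * b)^-1]. *)
Lemma integral_abs_gauss (R : realType) (b : R) : 0 < b ->
  (\int[@lebesgue_measure R]_x (`|x| * expR (- b * x ^+ 2))%:E)%E = (b^-1)%:E.
Proof.
move=> b0.
pose F (x : R) := - (2 * b)^-1 * expR (- b * x ^+ 2).
have dexp (x : R) :
    is_derive x 1 (fun x : R => expR (- b * x ^+ 2))
      (- (2 * b * x) * expR (- b * x ^+ 2)).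
  apply: is_derive_eq; rewrite /GRing.scale/=; ring.
have cexp : continuous (fun x : R => expR (- b * x ^+ 2)).
  move=> x; apply: differentiable_continuous.
  by apply/derivable1_diffP; case: (dexp x).
have dF (x : R) : is_derive x 1 F (x * expR (- b * x ^+ 2)).
  apply: is_derive_eq; rewrite /GRing.scale/=; field; lra.
have cF : continuous F.
  move=> x; apply: differentiable_continuous.
  by apply/derivable1_diffP; case: (dF x).
rewrite (@ge0_symfun_integralT _ (fun x => `|x| * expR (- b * x ^+ 2)));
  last first.
- by move=> x /=; rewrite normrN sqrrN.
- by move=> x; apply: continuousM; [exact: norm_continuous|exact: cexp].
- by move=> x; rewrite mulr_ge0// expR_ge0.
rewrite -set_itvcy.
under eq_integral => x.
  rewrite inE/= in_itv/= andbT => x0.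
  rewrite ger0_norm//; over.
rewrite (@ge0_continuous_FTC2y _ _ F 0 0).
- rewrite /F expr0n/= mulr0 expR0 mulr1 -EFinD -EFinM.
  congr EFin; field; lra.
- by move=> x x0; rewrite mulr_ge0// expR_ge0.
- apply: continuous_subspaceT => x.
  by apply: cvgM; [exact: cvg_id|exact: cexp].
- rewrite -[X in _ --> X](mulr0 (- (2 * b)^-1)).
  apply: cvgMr.
  under eq_fun do rewrite mulNr.
  apply: (@cvg_comp _ _ _ (fun x : R => b * x ^+ 2) (fun y => expR (- y)));
    last exact: cvgr_expR.
  (* Once [x] exceeds both [1] and [A / b], one has [A <= b * x <= b * x ^+ 2]. *)
  apply/cvgryPge => A; near=> x.
  have x1 : 1 <= x by near: x; apply: nbhs_pinfty_ge; exact: num_real.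
  have : A / b <= x by near: x; apply: nbhs_pinfty_ge; exact: num_real.
  rewrite ler_pdivrMr// => /le_trans; apply.
  by rewrite mulrC ler_pM2l// expr2 ler_peMr//; lra.
- by move=> x _; case: (dF x).
- exact/cvg_at_right_filter/cF.
- by move=> x _; rewrite derive1E; case: (dF x).
Unshelve. all: by end_near. Qed.

(** Integrate [|x| <= sqrt (1 + x^2) <= |x| + 1] against [w]: the extra [1] on the right contributes
    the total mass of [w]. *)
Lemma Rintegral_sqrt1Dsqr_bounds (R : realType) (w : R -> R) (m : R) :
  measurable_fun setT w -> (forall x, 0 <= w x) ->
  (\int[@lebesgue_measure R]_x (w x)%:E = 1)%E ->
  (\int[@lebesgue_measure R]_x (`|x| * w x)%:E = m%:E)%E ->
  m <= (\int[@lebesgue_measure R]_x (Num.sqrt (1 + x ^+ 2) * w x))%R <= m + 1.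
Proof.
move=> mw w0 w1 wm.
have mx : measurable_fun [set: R] (fun x : R => `|x| * w x).
  by apply: measurable_funM => //; exact: measurableT_comp.
have ms : measurable_fun [set: R] (fun x : R => Num.sqrt (1 + x ^+ 2) * w x).
  apply: measurable_funM => //; apply: measurableT_comp => //.
  apply: continuous_measurable_fun; exact: sqrt_continuous.
  apply: measurable_funD => //.
have lo : (m%:E <= \int[@lebesgue_measure R]_x (Num.sqrt (1 + x ^+ 2) * w x)%:E)%E.
  rewrite -wm; apply: ge0_le_integral => //=.
  - by move=> x _; rewrite lee_fin mulr_ge0.
  - exact/measurable_EFinP.
  - exact/measurable_EFinP.
  - move=> x _; rewrite lee_fin ler_wpM2r// -sqrtr_sqr ler_wsqrtr//; lra.
have hi : (\int[@lebesgue_measure R]_x (Num.sqrt (1 + x ^+ 2) * w x)%:E <= (m + 1)%:E)%E.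
  rewrite EFinD -wm -w1 -ge0_integralD//=; last first.
  - exact/measurable_EFinP.
  - by move=> x _; rewrite lee_fin.
  - exact/measurable_EFinP.
  - by move=> x _; rewrite lee_fin mulr_ge0.
  apply: ge0_le_integral => //=.
  - by move=> x _; rewrite lee_fin mulr_ge0// sqrtr_ge0.
  - exact/measurable_EFinP.
  - by apply: emeasurable_funD; exact/measurable_EFinP.
  - move=> x _; rewrite -EFinD lee_fin.
    rewrite -[X in _ <= _ + X]mul1r -mulrDl.
    (* Writing [|x| + 1] as the root of its square reduces the bound to [1 + x^2 <= (|x| + 1)^2]. *)
    rewrite ler_wpM2r// -[leRHS]ger0_norm ?addr_ge0// -[leRHS]sqrtr_sqr ler_sqrt ?sqr_ge0//.
    by rewrite sqrrD real_normK ?num_real//; have := normr_ge0 x; lra.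
(* The upper bound makes the extended integral finite, so [fine] in [Rintegral] returns its true
   value and not the default [0]. *)
have fE : (\int[@lebesgue_measure R]_x (Num.sqrt (1 + x ^+ 2) * w x)%:E)%E \is a fin_num.
  rewrite ge0_fin_numE; first exact: le_lt_trans hi (ltry _).
  by apply: integral_ge0 => x _; rewrite lee_fin mulr_ge0// sqrtr_ge0.
by rewrite /Rintegral -!lee_fin fineK// lo hi.
Qed.

Lemma powR_3half (R : realType) (x : R) : 0 <= x -> x `^ (3 / 2) = Num.sqrt (x ^+ 3).
Proof. by move=> x0; rewrite powRrM powR_mulrn// powR12_sqrt// exprn_ge0. Qed.

(** With [b = 1 / (2 s^2)] the density is [normal_peak s] times [expR (- b * x ^+ 2)], so the value
    is [2 s^2 / sqrt (2 pi s^2)]. *)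
Lemma integral_abs_normal_pdf (R : realType) (s : R) : 0 < s ->
  (\int[@lebesgue_measure R]_x (`|x| * normal_pdf 0 s x)%:E
    = (s * Num.sqrt (2 / pi))%:E)%E.
Proof.
move=> s0; have pi0 := pi_gt0 R.
pose b := (2 * s ^+ 2)^-1.
have b0 : 0 < b by rewrite invr_gt0 mulr_gt0// exprn_gt0.
have mx : measurable_fun [set: R] (fun x : R => `|x| * expR (- b * x ^+ 2)).
  apply: continuous_measurable_fun => x; apply: cvgM.
    exact: norm_continuous.
  apply: continuous_comp; last exact: continuous_expR.
  by apply: cvgMr; exact: exprn_continuous.
transitivity (\int[@lebesgue_measure R]_x
    ((normal_peak s)%:E * (`|x| * expR (- b * x ^+ 2))%:E))%E.
  apply: eq_integral => x _.
  rewrite normal_pdfE ?gt_eqF// /normal_fun subr0 -EFinM; congr EFin.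
  rewrite mulrCA; congr (_ * (_ * expR _)).
  rewrite /b; field; lra.
rewrite ge0_integralZl//; last 2 first.
- exact/measurable_EFinP.
- by rewrite lee_fin normal_peak_ge0.
rewrite integral_abs_gauss// -EFinM; congr EFin.
rewrite /normal_peak /b invrK -mulrnAr sqrtrM ?sqr_ge0// sqrtr_sqr gtr0_norm//.
move: (@pi R) pi0 => p p0.
(* This form leaves [sqrt (2 / p)] as the only radical, the one in the target. *)
have -> : p *+ 2 = (2 / p) * p ^+ 2 :> R by field; lra.
rewrite sqrtrM; last by rewrite divr_ge0// ltW.
rewrite sqrtr_sqr gtr0_norm//.
have q2 : Num.sqrt (2 / p) ^+ 2 = 2 / p :> R by rewrite sqr_sqrtr// divr_ge0// ltW.
have q0 : 0 < Num.sqrt (2 / p) :> R by rewrite sqrtr_gt0 divr_gt0.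
(* The last factor equals [1]; it isolates the relation [q2], which [field] cannot see. *)
rewrite [_^-1 * _](_ : _ = (s * Num.sqrt (2 / p)) * (2 / p / Num.sqrt (2 / p) ^+ 2)); last first.
by field; rewrite !gt_eqF.
by rewrite q2 divff ?mulr1// gt_eqF// divr_gt0.
Qed.

(** For [sigma^2 = 2/3 L^3] with [L = ln (P T)], [1 / (2 sigma^2)] is [beta T] and
    [1 / sqrt (2 pi sigma^2)] is the prefactor of [w_infty]. *)
Lemma w_inftyE (R : realType) (T : R) : 0 < ln (P T) ->
  w_infty T = normal_pdf 0 (Num.sqrt (2 / 3 * ln (P T) ^+ 3)).
Proof.
rewrite /w_infty /beta; move: (ln _) => L L0.
have L3 : 0 < L ^+ 3 by rewrite exprn_gt0.
have q0 : 0 < 2 / 3 * L ^+ 3 by rewrite mulr_gt0.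
have pi0 := pi_gt0 R.
rewrite normal_pdfE; last by rewrite gt_eqF// sqrtr_gt0.
apply/funext => x; rewrite /normal_fun /normal_peak subr0 sqr_sqrtr ?ltW//.
congr (_ * expR _); last by field; lra.
rewrite powR_3half ?ltW//.
rewrite (_ : 2 / 3 * L ^+ 3 * pi *+ 2 = L ^+ 3 * (3 / pi)^-1 * 2 ^+ 2); last by field; lra.
have r0 : 0 < 3 / pi :> R by rewrite divr_gt0.
rewrite [in RHS]sqrtrM ?mulr_ge0 ?invr_ge0 ?ltW// sqrtr_sqr ger0_norm//.
rewrite [in RHS]sqrtrM ?ltW// [in RHS]sqrtrV ?ltW//.
have : 0 < Num.sqrt (L ^+ 3) by rewrite sqrtr_gt0.
have : 0 < Num.sqrt (3 / pi) :> R by rewrite sqrtr_gt0.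
move: (Num.sqrt (L ^+ 3)) (Num.sqrt (3 / pi)) => a c c0 a0.
by field; rewrite !gt_eqF.
Qed.

Lemma E_infty_Phi1_bounds (R : realType) (T : R) : 0 < ln (P T) ->
  Num.sqrt (4 / (3 * pi) * ln (P T) ^+ 3) <= E_infty_Phi1 T
    <= Num.sqrt (4 / (3 * pi) * ln (P T) ^+ 3) + 1.
Proof.
move=> L0.
have L3 : 0 < ln (P T) ^+ 3 by rewrite exprn_gt0.
have q0 : 0 < 2 / 3 * ln (P T) ^+ 3 by rewrite mulr_gt0.
have pi0 := pi_gt0 R.
rewrite /E_infty_Phi1 w_inftyE//; apply: Rintegral_sqrt1Dsqr_bounds.
- exact: measurable_normal_pdf.
- by move=> x; exact: normal_pdf_ge0.
- exact: integral_normal_pdf.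
- rewrite integral_abs_normal_pdf ?sqrtr_gt0// -sqrtrM ?ltW//; congr (Num.sqrt _)%:E.
  by field; lra.
Qed.

Lemma ln_P (R : realType) (T : R) : 0 < T -> ln (P T) = (ln T - ln (2 * pi)) / 2.
Proof.
move=> T0; have pi0 : 0 < 2 * pi :> R by rewrite mulr_gt0// pi_gt0.
rewrite /P -powR12_sqrt ?divr_ge0 ?ltW// ln_powR ln_div ?posrE//.
by rewrite mulrC.
Qed.

Lemma statistical_arc_lengthE (R : realType) (T u : R) : 0 <= u ->
  statistical_arc_length T u = E_infty_Phi1 T * u.
Proof.
move=> u0; rewrite /statistical_arc_length /E_infty_Phi2 Rintegral_cst//.
(* The length formula branches on [T < T + u]; the degenerate branch forces [u = 0]. *)
rewrite [X in fine X]lebesgue_measure_itv/= lte_fin ltrDl; case: ltP => [_|].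
  by rewrite -EFinD/= addrAC subrr add0r.
by move=> u0'; have -> : u = 0 by [apply/le_anti/andP]; rewrite mulr0.
Qed.

Theorem mainTheorem2 (R : realType) (U : R -> R)
    (hU : forall T : R, 2 * pi < T -> 0 < U T <= Num.sqrt T) :
  asymp_equiv
    (fun T => statistical_arc_length T (U T))
    (fun T => 1 / Num.sqrt (6 * pi) * U T * ln T `^ (3 / 2)).
Proof.
have pi0 := pi_gt0 R.
have sqrt6pi_gt0 : 0 < Num.sqrt (6 * pi) :> R by rewrite sqrtr_gt0 mulr_gt0.
(* The ratio will be squeezed between [lo] and [lo + err], where [err] is the additive error [1]
   divided by [ln^(3/2) T / sqrt (6 pi)]. Both limits follow from [1 / ln T --> 0] by continuity. *)
pose lo (T : R) := Num.sqrt ((1 - ln (2 * pi) / ln T) ^+ 3).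
pose err (T : R) := Num.sqrt (6 * pi) * Num.sqrt ((ln T)^-1 ^+ 3).
have lnV0 : (ln T)^-1 @[T --> +oo] --> (0 : R).
  apply/gtr0_cvgV0; last exact: cvgr_ln.
  near=> T; rewrite ln_gt0//; near: T; exact: nbhs_pinfty_gt (num_real _).
have sqrtX3 (f : R -> R) (a : R) : f T @[T --> +oo] --> a ->
    Num.sqrt (f T ^+ 3) @[T --> +oo] --> Num.sqrt (a ^+ 3).
  move=> fa; apply: continuous_cvg; first exact: sqrt_continuous.
  by apply: (@cvg_comp _ _ _ f (fun x => x ^+ 3) _ _ _ fa); exact: exprn_continuous.
have lo1 : lo T @[T --> +oo] --> (1 : R).
  rewrite -[X in _ --> X]sqrtr1 -[X in Num.sqrt X](expr1n _ 3); apply: sqrtX3.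
  rewrite -[X in _ --> X]subr0 -[X in _ - X](mulr0 (ln (2 * pi))).
  by apply: cvgB; [exact: cvg_cst|exact: cvgMr].
have err0 : err T @[T --> +oo] --> (0 : R).
  rewrite -[X in _ --> X](mulr0 (Num.sqrt (6 * pi))); apply: cvgMr.
  by rewrite -sqrtr0 -[X in Num.sqrt X](expr0n _ 3); exact: sqrtX3.
rewrite /asymp_equiv.
apply: (@squeeze_cvgr _ _ _ _ lo (fun T => lo T + err T)) => //; last first.
  by rewrite -[X in _ --> X]addr0; exact: cvgD.
near=> T.
(* Beyond [2 * pi], [ln (P T)] is positive, so the bounds on [E_infty_Phi1] apply. *)
have T2pi : 2 * pi < T by near: T; apply: nbhs_pinfty_gt; exact: num_real.
have T1 : 1 < T by near: T; apply: nbhs_pinfty_gt; exact: num_real.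
have lT : 0 < ln T by rewrite ln_gt0.
have T0 : 0 < T by lra.
have lTP : ln (2 * pi) < ln T by rewrite ltr_ln ?posrE ?mulr_gt0.
have LT : 0 < ln (P T) by rewrite ln_P// divr_gt0// subr_gt0.
have /andP[u0 _] := hU T T2pi.
rewrite (statistical_arc_lengthE _ (ltW u0)) (powR_3half (ltW lT)).
have s0 : 0 < Num.sqrt (ln T ^+ 3) by rewrite sqrtr_gt0 exprn_gt0.
have := E_infty_Phi1_bounds LT.
(* The halving in [ln_P] contributes [1/8] after cubing, and [4 / (3 pi) / 8 = 1 / (6 pi)]: this is
   the constant of the theorem. *)
have -> : 4 / (3 * pi) * ln (P T) ^+ 3 =
    (1 - ln (2 * pi) / ln T) ^+ 3 * ln T ^+ 3 * (6 * pi)^-1.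
  rewrite ln_P//; move: (ln _) (ln _) lT => a b; move: (@pi R) pi0 => p p0 b0; field.
  by rewrite !gt_eqF.
have A0 : 0 <= (1 - ln (2 * pi) / ln T) ^+ 3.
  by rewrite exprn_ge0// subr_ge0 ler_pdivrMr// mul1r ltW.
have -> : Num.sqrt ((1 - ln (2 * pi) / ln T) ^+ 3 * ln T ^+ 3 * (6 * pi)^-1) =
    lo T * Num.sqrt (ln T ^+ 3) / Num.sqrt (6 * pi).
  rewrite sqrtrM; last by rewrite mulr_ge0// exprn_ge0// ltW.
  rewrite sqrtrM// sqrtrV//.
  by rewrite mulr_ge0// ltW.
have -> : err T = Num.sqrt (6 * pi) / Num.sqrt (ln T ^+ 3).
  by rewrite /err exprVn sqrtrV// exprn_ge0// ltW.
(* Since [U T > 0], it cancels from the ratio. *)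
have -> e : e * U T / (1 / Num.sqrt (6 * pi) * U T * Num.sqrt (ln T ^+ 3)) =
    e / (Num.sqrt (ln T ^+ 3) / Num.sqrt (6 * pi)).
  move: (Num.sqrt (6 * pi)) (Num.sqrt (ln T ^+ 3)) (U T) sqrt6pi_gt0 s0 u0.
  by move=> c s u c0 s0 u0; field; rewrite !gt_eqF.
move=> /andP[Elo Ehi].
have q0 : 0 < Num.sqrt (ln T ^+ 3) / Num.sqrt (6 * pi) by rewrite divr_gt0.
rewrite ler_pdivlMr// mulrA Elo/= ler_pdivrMr// mulrDl mulrA.
rewrite (le_trans Ehi)// lerD2l mulrA divfK ?gt_eqF// divff ?gt_eqF//.
Unshelve. all: by end_near. Qed.
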